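(* Let $D=(P,\mathcal{B})$ be a non-trivial $(v,b,r,k,\lambda)$-BIBD and let $\Gamma_1(D)$ be its flag-graph. Then one of the following holds: (i) $\lambda=1$ and $\Gamma_1(D)$ is a $(vr,\,k+r-2,\,\{r-2,k-2\},\,\{0,1\})$-AQSRG; (ii) $\lambda\geq 2$ and $\Gamma_1(D)$ is a $(vr,\,k+r-2,\,\{r-2,k-2\},\,\{0,1,2\})$-AQSRG.
   Context: Let $v,b,r,k,\lambda$ be positive integers with $k>1$. A $(v,b,r,k,\lambda)$-balanced incomplete block design (BIBD) $D=(P,\mathcal{B})$ consists of a set $P$ of $v$ points and a set $\mathcal{B}$ of $b$ blocks, each block being a $k$-subset of $P$ (so there are no repeated blocks), such that every unordered pair of distinct points is contained in exactly $\lambda$ blocks; every point then lies in exactly $r$ blocks. $D$ is non-trivial if $v-k>1$. A flag of $D$ is an ordered pair $(p,c)$ with $p\in P$, $c\in\mathcal{B}$ and $p\in c$. The flag-graph $\Gamma_1(D)$ is the simple graph whose vertices are the flags of $D$, two different vertices $(p,c)$ and $(q,d)$ being adjacent if and only if $p=q$ or $c=d$. For finite sets $S,T$ of non-negative integers, an $(n,t,S,T)$-almost-quasi-strongly regular graph (AQSRG) is a graph on $n$ vertices that is $t$-regular, in which the number of common neighbours of any two adjacent vertices belongs to $S$, and the number of common neighbours of any two distinct non-adjacent vertices belongs to $T$. *)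

(* Defs.v *)
From mathcomp Require Import all_boot finmap.

Set Implicit Arguments.
Unset Strict Implicit.
Unset Printing Implicit Defensive.

(* The point set of a design is a whole finite type P; the blocks form a set
   of subsets of P, so repeated blocks are excluded. *)
Record is_bibd (v b r k lam : nat) (P : finType) (B : {set {set P}}) : Prop :=
  IsBibd {
    bibd_v_gt0 : 0 < v;
    bibd_b_gt0 : 0 < b;
    bibd_r_gt0 : 0 < r;
    bibd_lam_gt0 : 0 < lam;
    bibd_k_gt1 : 1 < k;
    bibd_points : #|P| = v;
    bibd_blocks : #|B| = b;
    bibd_block_size : forall c, c \in B -> #|c| = k;
    bibd_balance : forall p q : P, p != q ->
      #|[set c in B | (p \in c) && (q \in c)]| = lam;
    (* The other fields force a constant replication number; this field is
       what ties the parameter r to the design. *)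
    bibd_replication : forall p : P, #|[set c in B | p \in c]| = r }.

Record sgraph := SGraph {
  vertex :> finType;
  adj : rel vertex;
  adj_sym : symmetric adj;
  adj_irr : irreflexive adj }.

Definition neighbours (G : sgraph) (x : G) : {set G} := [set y | adj x y].

Record is_aqsrg (n t : nat) (S T : {fset nat}) (G : sgraph) : Prop := IsAqsrg {
  aqsrg_order : #|G| = n;
  aqsrg_regular : forall x : G, #|neighbours x| = t;
  aqsrg_adj : forall x y : G, adj x y ->
    #|neighbours x :&: neighbours y| \in S;
  aqsrg_nonadj : forall x y : G, x != y -> ~~ adj x y ->
    #|neighbours x :&: neighbours y| \in T }.

Section FlagGraph.

Variables (P : finType) (B : {set {set P}}).

Definition flag : finType :=
  {f : P * {set P} | (f.2 \in B) && (f.1 \in f.2)}.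

Definition flag_point (f : flag) : P := (val f).1.

Definition flag_block (f : flag) : {set P} := (val f).2.

Definition flag_adj (f g : flag) : bool :=
  (f != g) &&
  ((flag_point f == flag_point g) || (flag_block f == flag_block g)).

Lemma flag_adj_sym : symmetric flag_adj.
Proof.
by move=> f g; rewrite /flag_adj eq_sym (eq_sym (flag_point f))
  (eq_sym (flag_block f)).
Qed.

Lemma flag_adj_irr : irreflexive flag_adj.
Proof. by move=> f; rewrite /flag_adj eqxx. Qed.

Definition flag_graph : sgraph := SGraph flag_adj_sym flag_adj_irr.

End FlagGraph.

(* Main.v *)
Require Import Defs.
From mathcomp Require Import all_boot finmap.

Set Implicit Arguments.
Unset Strict Implicit.
Unset Printing Implicit Defensive.

(** The flags form a partial grid: a flag is determined by its point (its row)
    and its block (its column), and two flags are adjacent when they share a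
    line of the grid. Every row has [r] flags and every column has [k] flags,
    and a row meets a column in at most one flag ([card_flags_at_on]).

    The rows partition the flags, so there are [v * r] of them. The neighbours
    of a flag are the other flags of its row and of its column, so there are
    [(r - 1) + (k - 1)]. Two adjacent flags share exactly one line, and their
    common neighbours are the other flags of that line ([r - 2] or [k - 2]):
    a flag off it would have to lie on the second line of each of the two, and
    these are parallel. Two non-adjacent flags [(p, c)] and [(q, d)] share no
    line, so their common neighbours lie at the two remaining corners [(p, d)]
    and [(q, c)] of the rectangle that they span ([card_common_nonadj]), hence
    number at most two. If both corners are flags, then [c] and [d] are two
    distinct blocks through both [p] and [q]; so when [lam = 1] at most one
    corner is a flag ([corners_leq1]). *)

Section FlagGeometry.

Variables (P : finType) (B : {set {set P}}).
Implicit Types (x y : flag B) (p q : P) (c d : {set P}).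

Definition flags_at p : {set flag B} := [set x | flag_point x == p].
Definition flags_on c : {set flag B} := [set x | flag_block x == c].

Lemma flag_block_in x : flag_block x \in B.
Proof. by case/andP: (valP x). Qed.

Lemma flag_incident x : flag_point x \in flag_block x.
Proof. by case/andP: (valP x). Qed.

Lemma flag_ext x y :
  flag_point x = flag_point y -> flag_block x = flag_block y -> x = y.
Proof.
move=> exy fxy; apply: val_inj; move: exy fxy.
by rewrite /flag_point /flag_block; case: (val x) (val y) => ? ? [? ?] /= -> ->.
Qed.

Lemma card_flags_at p : #|flags_at p| = #|[set c in B | p \in c]|.
Proof.
rewrite -(card_in_imset (f := @flag_block P B) (D := mem (flags_at p))).
  apply: eq_card => c; rewrite inE; apply/imsetP/andP => [[x]|[cB pc]].
    by rewrite inE => /eqP <- ->; rewrite flag_block_in flag_incident.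
  have pcF : (c \in B) && (p \in c) by rewrite cB.
  by exists (Sub (p, c) pcF : flag B); rewrite ?inE /flag_point /flag_block SubK.
by move=> x y; rewrite !inE => /eqP <- /eqP exy /(flag_ext (esym exy)).
Qed.

Lemma card_flags_on c : c \in B -> #|flags_on c| = #|c|.
Proof.
move=> cB.
rewrite -(card_in_imset (f := @flag_point P B) (D := mem (flags_on c))).
  apply: eq_card => p; apply/imsetP/idP => [[x]|pc].
    by rewrite inE => /eqP <- ->; rewrite flag_incident.
  have pcF : (c \in B) && (p \in c) by rewrite cB.
  by exists (Sub (p, c) pcF : flag B); rewrite ?inE /flag_point /flag_block SubK.
move=> x y; rewrite !inE => /eqP <- /eqP exy pxy.
exact: flag_ext pxy (esym exy).
Qed.

Lemma flags_at_on x :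
  flags_at (flag_point x) :&: flags_on (flag_block x) = [set x].
Proof.
apply/setP=> y; rewrite !inE; apply/andP/eqP => [[/eqP ? /eqP ?]|-> //].
exact: flag_ext.
Qed.

(** The bound is the incidence itself, read as 0 or 1, so that adding the bounds
    for two corners counts how many of them are flags. *)
Lemma card_flags_at_on p c : #|flags_at p :&: flags_on c| <= (p \in c).
Proof.
have [->|[x]] := set_0Vmem (flags_at p :&: flags_on c); first by rewrite cards0.
rewrite !inE => /andP[/eqP <- /eqP <-].
by rewrite flags_at_on cards1 flag_incident.
Qed.

Lemma card_flag r : (forall p, #|[set c in B | p \in c]| = r) ->
  #|flag B| = #|P| * r.
Proof.
move=> rB; rewrite -sum1_card (partition_big (@flag_point P B) predT) //=.
rewrite -sum_nat_const; apply: eq_bigr => p _.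
by rewrite sum1_card -(rB p) -card_flags_at; apply: eq_card => x; rewrite inE.
Qed.

Lemma flag_neighboursE x :
  neighbours (G := flag_graph B) x =
  (flags_at (flag_point x) :|: flags_on (flag_block x)) :\ x.
Proof.
apply/setP=> y; rewrite !inE /= /flag_adj eq_sym.
by rewrite (eq_sym (flag_point x)) (eq_sym (flag_block x)).
Qed.

Lemma card_flag_neighbours x :
  #|neighbours (G := flag_graph B) x| =
  (#|flags_at (flag_point x)| + #|flags_on (flag_block x)|) - 2.
Proof.
have xU : x \in flags_at (flag_point x) :|: flags_on (flag_block x).
  by rewrite !inE !eqxx.
rewrite flag_neighboursE (subnDA 1 _ 1).
have := cardsU (flags_at (flag_point x)) (flags_on (flag_block x)).
by rewrite flags_at_on cards1 (cardsD1 x) xU => <-; rewrite addKn.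
Qed.

Lemma card_setD2 {T : finType} (A : {set T}) (x y : T) :
  x \in A -> y \in A -> x != y -> #|A :\ x :\ y| = #|A| - 2.
Proof.
move=> xA yA nxy.
by rewrite (cardsD1 x A) (cardsD1 y (A :\ x)) !inE xA yA eq_sym nxy addnA addKn.
Qed.

Lemma card_common_same_point x y : x != y -> flag_point x = flag_point y ->
  #|neighbours (G := flag_graph B) x :&: neighbours (G := flag_graph B) y| =
  #|flags_at (flag_point x)| - 2.
Proof.
move=> nxy exy.
rewrite -(card_setD2 (x := x) (y := y)) ?inE ?exy //; apply: eq_card => z.
rewrite !flag_neighboursE !inE exy.
have [_|_] := eqVneq (flag_point z) (flag_point y).
  by case: (z == x); case: (z == y).
(* Off the common row, z would have to lie in the columns of both x and y,
   which would force x = y. *)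
have [zx|_] := eqVneq (flag_block z) (flag_block x).
  have [zy|_] := eqVneq (flag_block z) (flag_block y).
    by case/eqP: nxy; apply: flag_ext exy (etrans (esym zx) zy).
  by case: (z == x); case: (z == y).
by case: (z == x); case: (z == y).
Qed.

Lemma card_common_same_block x y : x != y -> flag_block x = flag_block y ->
  #|neighbours (G := flag_graph B) x :&: neighbours (G := flag_graph B) y| =
  #|flags_on (flag_block x)| - 2.
Proof.
move=> nxy exy.
rewrite -(card_setD2 (x := x) (y := y)) ?inE ?exy //; apply: eq_card => z.
rewrite !flag_neighboursE !inE exy.
have [_|_] := eqVneq (flag_block z) (flag_block y).
  by rewrite !orbT; case: (z == x); case: (z == y).
have [zx|_] := eqVneq (flag_point z) (flag_point x).
  have [zy|_] := eqVneq (flag_point z) (flag_point y).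
    by case/eqP: nxy; apply: flag_ext (etrans (esym zx) zy) exy.
  by case: (z == x); case: (z == y).
by case: (z == x); case: (z == y).
Qed.

(** A common neighbour shares its point with one of [x] and [y] and its block
    with the other, because no flag shares its point, or its block, with
    both. *)
Lemma card_common_nonadj x y :
  flag_point x != flag_point y -> flag_block x != flag_block y ->
  #|neighbours (G := flag_graph B) x :&: neighbours (G := flag_graph B) y| <=
  (flag_point x \in flag_block y) + (flag_point y \in flag_block x).
Proof.
move=> npt nbl.
apply: leq_trans (leq_add (card_flags_at_on _ _) (card_flags_at_on _ _)).
apply: leq_trans (leq_card_setU _ _); apply: subset_leq_card.
apply/subsetP=> z; rewrite !flag_neighboursE !inE.
case/andP=> /andP[_ /orP[]/eqP ->] /andP[_].
  by rewrite (negPf npt) /= eqxx => ->.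
by rewrite (negPf nbl) orbF eqxx andbT orbC => ->.
Qed.

(** If [(p, d)] and [(q, c)] were both flags, then [c] and [d] would be two
    distinct blocks through both [p] and [q]. *)
Lemma corners_leq1 p q c d :
  #|[set e in B | (p \in e) && (q \in e)]| = 1 ->
  c \in B -> d \in B -> p \in c -> q \in d -> c != d ->
  (p \in d) + (q \in c) <= 1.
Proof.
move=> lam1 cB dB pc qd ncd.
case pd: (p \in d); case qc: (q \in c) => //; case/eqP: ncd.
move/eqP/cards1P: lam1 => [e Ee].
have: c \in [set e] by rewrite -Ee inE cB pc qc.
have: d \in [set e] by rewrite -Ee inE dB pd qd.
by rewrite !inE => /eqP -> /eqP ->.
Qed.

End FlagGeometry.

(** Only the bound on common neighbours of non-adjacent flags depends on
    [lam], so the two cases of the classification share this reduction. *)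
Lemma flag_graph_aqsrg (v b r k lam : nat) (P : finType) (B : {set {set P}})
    (T : {fset nat}) : is_bibd v b r k lam B ->
  (forall x y : flag B,
     flag_point x != flag_point y -> flag_block x != flag_block y ->
     #|neighbours (G := flag_graph B) x :&: neighbours (G := flag_graph B) y|
       \in T) ->
  is_aqsrg (v * r) (k + r - 2) [fset r - 2; k - 2]%fset T (flag_graph B).
Proof.
move=> D HT.
have row p : #|flags_at B p| = r.
  by rewrite card_flags_at (bibd_replication D).
have col (x : flag B) : #|flags_on B (flag_block x)| = k.
  by rewrite card_flags_on ?(bibd_block_size D) // flag_block_in.
split.
- by rewrite (card_flag (bibd_replication D)) (bibd_points D).
- by move=> x; rewrite card_flag_neighbours row col addnC.
- move=> x y /andP[nxy /orP[]/eqP exy]; rewrite !inE.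
    by rewrite card_common_same_point // row eqxx.
  by rewrite card_common_same_block // col eqxx orbT.
- move=> x y nxy; rewrite /= /flag_adj nxy /= negb_or => /andP[].
  exact: HT.
Qed.

Theorem theorem1 (v b r k lam : nat) (P : finType) (B : {set {set P}})
    (HD : is_bibd v b r k lam B) (Hnontrivial : 1 < v - k) :
  (lam = 1 /\
   is_aqsrg (v * r) (k + r - 2)
     [fset r - 2; k - 2]%fset [fset 0; 1]%fset (flag_graph B))
  \/
  (2 <= lam /\
   is_aqsrg (v * r) (k + r - 2)
     [fset r - 2; k - 2]%fset [fset 0; 1; 2]%fset (flag_graph B)).
Proof.
have: 0 < lam := bibd_lam_gt0 HD.
rewrite leq_eqVlt => /orP[/eqP/esym lamE|lam_gt1]; [left | right]; split=> //.
- apply: (flag_graph_aqsrg HD) => x y npt nbl.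
  have lam1 : #|[set c in B | (flag_point x \in c) && (flag_point y \in c)]| = 1.
    by rewrite (bibd_balance HD npt) lamE.
  have := leq_trans (card_common_nonadj npt nbl)
    (corners_leq1 lam1 (flag_block_in x) (flag_block_in y)
       (flag_incident x) (flag_incident y) nbl).
  by rewrite !inE; case: #|_| => [|[|]].
- apply: (flag_graph_aqsrg HD) => x y npt nbl.
  have := card_common_nonadj npt nbl; rewrite !inE.
  by case: (_ \in _); case: (_ \in _); case: #|_| => [|[|[|]]].
Qed.
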